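(* If $\tau \in \{0010,0100,0110,0123\}$, then $$f_\tau(x)=\frac{(1-x)(1-4x+4x^2+x^3)}{(1-2x)^3}$$ as formal power series in $x$, where $f_\tau(x)=\sum_{n\ge 0} b_n(\tau)x^n$ and $b_n(\tau)$ is the number of ascent sequences of length $n$ that avoid both patterns $021$ and $\tau$.
   Context: For a finite sequence $w=w_1\cdots w_n$ of integers, $\mathrm{asc}(w)$ is the number of indices $1\le i\le n-1$ with $w_i<w_{i+1}$. An ascent sequence of length $n\ge 1$ is a sequence $a_1\cdots a_n$ of non-negative integers such that $a_1=0$ and $a_i\le \mathrm{asc}(a_1\cdots a_{i-1})+1$ for $1<i\le n$; there is exactly one (empty) ascent sequence of length $0$. A sequence $\pi=\pi_1\cdots\pi_n$ contains a pattern $\tau=\tau_1\cdots\tau_m$ if there are indices $1\le i_1<\cdots<i_m\le n$ such that for all $j,k\in\{1,\dots,m\}$: $\pi_{i_j}<\pi_{i_k}$ iff $\tau_j<\tau_k$, and $\pi_{i_j}=\pi_{i_k}$ iff $\tau_j=\tau_k$; otherwise $\pi$ avoids $\tau$. For a pattern $\tau$, $B_n(\tau)$ is the set of ascent sequences of length $n$ avoiding both $021$ and $\tau$ (with $B_0(\tau)$ consisting of the empty sequence), and $b_n(\tau)=|B_n(\tau)|$. *)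

(* Defs.v *)
From mathcomp Require Import all_boot all_order all_algebra.

Set Implicit Arguments.
Unset Strict Implicit.
Unset Printing Implicit Defensive.

Import GRing.Theory.

Definition asc (w : seq nat) : nat :=
  \sum_(0 <= i < (size w).-1) (nth 0 w i < nth 0 w i.+1).

(* Entries are indexed from 0, so the bound on entry [i] involves the prefix
   [take i a] of the entries strictly before it. *)
Definition ascent_seq (a : seq nat) : bool :=
  ((a != [::]) ==> (nth 0 a 0 == 0)) &&
  [forall i : 'I_(size a), (0 < i) ==> (nth 0 a i <= asc (take i a) + 1)].

Definition contains (pi tau : seq nat) : bool :=
  [exists f : {ffun 'I_(size tau) -> 'I_(size pi)},
    [forall j : 'I_(size tau), forall k : 'I_(size tau),
      [&& (j < k) ==> (f j < f k),
          (nth 0 pi (f j) < nth 0 pi (f k)) == (nth 0 tau j < nth 0 tau k)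
        & (nth 0 pi (f j) == nth 0 pi (f k)) == (nth 0 tau j == nth 0 tau k)]]].

Definition avoids (pi tau : seq nat) : bool := ~~ contains pi tau.

Definition inB (n : nat) (tau w : seq nat) : bool :=
  [&& size w == n, ascent_seq w, avoids w [:: 0; 2; 1] & avoids w tau].

(* An ascent sequence of length n has all its entries below n, so that [inB n tau]
   can be counted inside the finite type of n-tuples over 'I_n; lemma [card_inB]
   shows that nothing is lost. *)
Definition b (n : nat) (tau : seq nat) : nat :=
  #|[set w : n.-tuple 'I_n | inB n tau (map val w)]|.

Lemma asc_ub w : asc w <= (size w).-1.
Proof.
rewrite /asc; apply: (@leq_trans (\sum_(0 <= i < (size w).-1) 1)).
  by apply: leq_sum => i _; case: (_ < _).
by rewrite sum_nat_const_nat muln1 subn0.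
Qed.

Lemma ascent_seq_lt a i : ascent_seq a -> i < size a -> nth 0 a i < size a.
Proof.
move=> /andP[a0 /forallP h] ia; case: (posnP i) => [i0|i_gt0].
  have aN : a != [::] by rewrite -size_eq0 -lt0n (leq_ltn_trans _ ia).
  by move: a0 ia; rewrite i0 aN /= => /eqP ->.
have := h (Ordinal ia); rewrite /= i_gt0 /= => hi.
apply: leq_ltn_trans hi _; apply: (leq_ltn_trans _ ia).
have := asc_ub (take i a); rewrite size_take ia => hle.
by rewrite addn1; apply: leq_ltn_trans hle _; rewrite prednK.
Qed.

Lemma card_inB n tau :
  exists2 s : seq (seq nat), uniq s /\ s =i [pred w | inB n tau w] & size s = b n tau.
Proof.
set A := [set w : n.-tuple 'I_n | inB n tau (map val w)].
have inj : injective (fun w : n.-tuple 'I_n => map val w).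
  by move=> u v /(inj_map val_inj) /val_inj.
exists [seq map val (w : n.-tuple 'I_n) | w <- enum A]; last first.
  by rewrite size_map -cardE.
split; first by rewrite (map_inj_uniq inj) enum_uniq.
move=> w; rewrite inE; apply/mapP/idP => [[u]|wB].
  by rewrite mem_enum inE => uB ->.
have /and4P[/eqP szw aw _ _] := wB.
have wlt x : x \in w -> x < n.
  by move=> /(nthP 0)[i iw <-]; rewrite -szw; apply: ascent_seq_lt.
have szu : size (pmap insub w : seq 'I_n) == n.
  rewrite size_pmap_sub -[X in _ == X]szw -all_count.
  by apply/allP.
have valu : map val (pmap insub w : seq 'I_n) = w.
  rewrite (pmap_filter (insubK _)) (eq_filter (a2 := fun x => x < n)).
    by apply/all_filterP/allP.
  by move=> x; rewrite isSome_insub.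
by exists (Tuple szu); rewrite ?mem_enum ?inE /= valu.
Qed.

Local Open Scope ring_scope.

(* A formal power series is its sequence of coefficients; two series are equal
   when all their coefficients are, i.e. [f =1 g]. *)
Definition fps (R : Type) := nat -> R.

Definition fps_of_poly (R : fieldType) (p : {poly R}) : fps R := fun n => p`_n.

Definition fps_mul (R : fieldType) (f g : fps R) : fps R :=
  fun n => \sum_(i < n.+1) f i * g (n - i)%N.

(* The first n coefficients of the multiplicative inverse of f: the n-th one
   is obtained by solving for it in the n-th coefficient of f * f^-1 = 1. *)
Fixpoint fps_inv_coefs (R : fieldType) (f : fps R) (n : nat) : seq R :=
  if n is m.+1 then
    let s := fps_inv_coefs f m in
    rcons s ((f 0%N)^-1 * ((m == 0%N)%:R - \sum_(i < m) f (m - i)%N * s`_i))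
  else [::].

Definition fps_inv (R : fieldType) (f : fps R) : fps R :=
  fun n => (fps_inv_coefs f n.+1)`_n.

Definition fps_div (R : fieldType) (f g : fps R) : fps R := fps_mul f (fps_inv g).

Lemma size_fps_inv_coefs (R : fieldType) (f : fps R) n :
  size (fps_inv_coefs f n) = n.
Proof. by elim: n => //= n IH; rewrite size_rcons IH. Qed.

Lemma nth_fps_inv_coefs (R : fieldType) (f : fps R) n i :
  (i < n)%N -> (fps_inv_coefs f n)`_i = fps_inv f i.
Proof.
elim: n => // n IH; rewrite ltnS leq_eqVlt => /orP[/eqP -> //|lt_in].
by rewrite /= nth_rcons size_fps_inv_coefs lt_in IH.
Qed.

Lemma fps_mulV (R : fieldType) (f : fps R) :
  f 0%N != 0 -> fps_mul f (fps_inv f) =1 fps_of_poly 1.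
Proof.
move=> f0 n; rewrite /fps_mul /fps_of_poly coef1.
rewrite (reindex_inj rev_ord_inj) /= big_ord_recr /= subSS subnn subn0.
rewrite {2}/fps_inv /= nth_rcons size_fps_inv_coefs ltnn eqxx mulrA divff // mul1r.
rewrite addrC -[RHS](subrK (\sum_(i < n) f (n - i)%N * (fps_inv_coefs f n)`_i)).
congr (_ + _); apply: eq_bigr => i _.
by rewrite subSS nth_fps_inv_coefs // subKn // ltnW.
Qed.

Definition gen_fun (tau : seq nat) : fps rat := fun n => (b n tau)%:R.

(* Main.v *)
(** An ascent sequence avoids 021 exactly when its positive letters weakly
    increase, so a positive letter [x] can be appended to [w] only if
    [max w <= x <= asc w + 1]. Hence the number of ways to extend [w] by [k]
    letters depends only on the slack [asc w - max w], on whether [w] ends with a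
    zero, and on which letters [tau] still permits. For 0010, 0100 and 0110 an
    occurrence can only be completed by a zero, and once zeros are forbidden the
    slack is at most 1; for 0123 it is completed by a third positive value. In each
    case the numbers of extensions satisfy a finite linear recurrence, solved by
    [2 ^ k] times a quadratic polynomial, and all four patterns give
    [32 b_n = 2 ^ n (n ^ 2 - n + 14)] for [n >= 2]. These are the coefficients of
    the rational function, as [1 / (1 - 2 x) ^ 3] has coefficients
    [2 ^ n (n + 1) (n + 2) / 2]. *)

Require Import Defs.
From mathcomp Require Import all_boot all_order all_algebra zify ring lra.

Import GRing.Theory.

(** * Pattern containment and appended letters *)

Lemma subseq_rcons_cases (T : eqType) (s w : seq T) (x : T) :
  subseq s (rcons w x) ->
  subseq s w \/ exists2 s', s = rcons s' x & subseq s' w.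
Proof.
rewrite -subseq_rev rev_rcons; case: (lastP s) => [|s' y]; first by left; apply: sub0seq.
rewrite rev_rcons /=; case: eqP => [-> | _].
  by rewrite subseq_rev => h; right; exists s'.
by rewrite -rev_rcons subseq_rev; left.
Qed.

Lemma subseq_rcons2 (T : eqType) (s w : seq T) (x : T) :
  subseq s w -> subseq (rcons s x) (rcons w x).
Proof. by move=> h; rewrite -!cats1; apply: cat_subseq. Qed.

Lemma pairwise_subseqP (T : eqType) (r : rel T) (w : seq T) :
  reflect (forall u v, subseq [:: u; v] w -> r u v) (pairwise r w).
Proof.
apply: (iffP idP) => [pw u v uv | ].
  by have := subseq_pairwise uv pw; rewrite /= !andbT.
elim: w => //= x w IH h; apply/andP; split.
  by apply/allP => y yw; apply: h; rewrite eqxx sub1seq.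
apply: IH => u v uv; apply: h; case: eqP => // _.
exact: subseq_trans (subseq_cons _ _) uv.
Qed.

Lemma pairwise_subseqPn (T : eqType) (r : rel T) (w : seq T) :
  ~~ pairwise r w -> exists u v, subseq [:: u; v] w /\ ~~ r u v.
Proof.
elim: w => //= x w IH; rewrite negb_and => /orP[/allPn[y yw ruy] | /IH[u [v [uv ruv]]]].
  by exists x, y; rewrite eqxx sub1seq.
exists u, v; split=> //; case: eqP => // _.
exact: subseq_trans (subseq_cons _ _) uv.
Qed.

(** Order isomorphism of words, with indices drawn from [iota] rather than from ordinals so that it
    computes by simplification once the pattern is explicit. *)
Definition same_order (s t : seq nat) : bool :=
  (size s == size t) &&
  all (fun j => all (fun k =>
    [&& (nth 0 s j < nth 0 s k) == (nth 0 t j < nth 0 t k)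
      & (nth 0 s j == nth 0 s k) == (nth 0 t j == nth 0 t k)])
    (iota 0 (size t))) (iota 0 (size t)).

Lemma contains_subseqP (w t : seq nat) :
  reflect (exists2 s, subseq s w & same_order s t) (contains w t).
Proof.
apply: (iffP existsP) => [[f /forallP fP] | [s sw /andP[/eqP sz_s /allP iso]]].
  pose s := [seq nth 0 w (f j) | j <- enum 'I_(size t)].
  have sz_s : size s = size t by rewrite size_map size_enum_ord.
  have nth_s (j : 'I_(size t)) : nth 0 s j = nth 0 w (f j).
    by rewrite (nth_map j) ?size_enum_ord // nth_ord_enum.
  exists s.
    pose I := [seq val (f j) | j <- enum 'I_(size t)].
    have I_sorted : sorted ltn I.
      rewrite sorted_map; apply: (@sub_sorted _ (relpre val ltn)).
        by move=> j k jk; have /forallP/(_ k)/and3P[/implyP h _ _] := fP j; apply: h.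
      by rewrite -sorted_map val_enum_ord iota_ltn_sorted.
    have -> : s = [seq nth 0 w i | i <- I] by rewrite -map_comp.
    (* A strictly increasing list is determined by its members, so [I] is a sublist of
       [iota 0 (size w)] and [s] a subsequence of [w]. *)
    have -> : I = filter (mem I) (iota 0 (size w)).
      apply: (irr_sorted_eq ltn_trans ltnn) => //.
        by apply: sorted_filter; [exact: ltn_trans | exact: iota_ltn_sorted].
      move=> i; rewrite mem_filter mem_iota /= add0n.
      by case iI: (i \in I) => //=; move/mapP: iI => [j _ ->]; rewrite ltn_ord.
    rewrite -[X in subseq _ X](take_size w) -(map_nth_iota0 0 (leqnn _)).
    by apply: map_subseq; apply: filter_subseq.
  rewrite /same_order sz_s eqxx; apply/allP => j; rewrite mem_iota /= => jt.
  apply/allP => k; rewrite mem_iota /= => kt.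
  have /forallP/(_ (Ordinal kt))/and3P[_] := fP (Ordinal jt).
  by rewrite -!nth_s /= => -> ->.
have [m sz_m def_s] := subseqP sw.
pose I := mask m (iota 0 (size w)).
have sI : s = [seq nth 0 w i | i <- I].
  by rewrite def_s /I map_mask (map_nth_iota0 0 (leqnn _)) take_size.
have sz_I : size I = size t by rewrite -sz_s sI size_map.
have I_sorted : sorted ltn I.
  apply: (subseq_sorted ltn_trans (mask_subseq _ _)); exact: iota_ltn_sorted.
have I_lt (j : 'I_(size t)) : nth 0 I j < size w.
  have : nth 0 I j \in I by rewrite mem_nth // sz_I.
  by move/mem_mask; rewrite mem_iota.
exists [ffun j => Ordinal (I_lt j)]; apply/forallP => j; apply/forallP => k.
have := iso j; rewrite mem_iota /= => /(_ (ltn_ord j))/allP/(_ k).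
rewrite mem_iota /= => /(_ (ltn_ord k)).
rewrite sI !(nth_map 0) ?sz_I // !ffunE /= => ->; rewrite andbT.
apply/implyP => jk; apply: (sorted_ltn_nth ltn_trans) => //; by rewrite inE sz_I.
Qed.

(** A new occurrence must use the appended letter, and use it last; [s] holds its other letters. *)
Lemma contains_rconsP (w t : seq nat) (x : nat) :
  reflect (contains w t \/ exists2 s, subseq s w & same_order (rcons s x) t)
    (contains (rcons w x) t).
Proof.
apply: (iffP idP) => [/contains_subseqP[s /subseq_rcons_cases[sw | [s' -> sw]] st] |].
- by left; apply/contains_subseqP; exists s.
- by right; exists s'.
case=> [/contains_subseqP[s sw st] | [s sw st]]; apply/contains_subseqP.
  by exists s => //; apply: subseq_trans sw (subseq_rcons _ _).
by exists (rcons s x) => //; apply: subseq_rcons2.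
Qed.

Lemma asc_rcons (w : seq nat) (x : nat) :
  w != [::] -> asc (rcons w x) = asc w + (last 0 w < x).
Proof.
case/lastP: w => // w y _; rewrite /asc !size_rcons /= last_rcons.
rewrite big_nat_recr //= !nth_rcons !size_rcons !ltnn !eqxx leqnn.
congr (_ + _); apply: eq_big_nat => i /andP[_ iw].
by rewrite !nth_rcons !size_rcons !ltnS iw (ltnW iw).
Qed.

Lemma ascent_seq_rcons (w : seq nat) (x : nat) :
  w != [::] -> ascent_seq (rcons w x) = ascent_seq w && (x <= asc w + 1).
Proof.
move=> w0; have w_gt0 : 0 < size w by rewrite lt0n size_eq0.
rewrite /ascent_seq -size_eq0 size_rcons /= w0 /= nth_rcons w_gt0 -andbA.
congr (_ && _); apply/forallP/andP => [h | [/forallP h hx] i].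
  split.
    apply/forallP => i; have := h (widen_ord (leqnSn _) i).
    by rewrite /= nth_rcons ltn_ord -cats1 takel_cat // ltnW.
  have := h ord_max; rewrite /= w_gt0 nth_rcons ltnn eqxx.
  by rewrite -cats1 takel_cat // take_size.
rewrite nth_rcons -cats1 takel_cat; last by rewrite -ltnS.
have := ltn_ord i; rewrite ltnS leq_eqVlt => /orP[/eqP iw | iw].
  by rewrite iw ltnn eqxx take_size hx implybT.
by rewrite iw; apply: (h (Ordinal iw)).
Qed.

(** * Letters that can be appended *)

Definition mx (w : seq nat) : nat := \max_(y <- w) y.

Lemma leq_mx (w : seq nat) (y : nat) : y \in w -> y <= mx w.
Proof. by move=> yw; apply: (leq_bigmax_seq (P := predT) (F := id)). Qed.

Lemma mx_rcons (w : seq nat) (x : nat) : mx (rcons w x) = maxn (mx w) x.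
Proof. by rewrite /mx -cats1 big_cat big_seq1. Qed.

Lemma mx_in (w : seq nat) : 0 < mx w -> mx w \in w.
Proof.
rewrite /mx; elim: w => [|y w IH]; first by rewrite big_nil.
rewrite big_cons inE; case: (leqP y (\max_(z <- w) z)) => yw.
  by move/IH => ->; rewrite orbT.
by rewrite eqxx.
Qed.

(* For [w] starting with 0: whether a zero, resp. a positive letter [x] at least
   the maximum of [w], can be appended without completing an occurrence of [tau].
   The initial 0 can serve as the first letter of an occurrence, so a condition on
   the pairs of letters after it decides this. *)
Definition zero_ok (tau w : seq nat) : bool :=
  if tau == [:: 0; 0; 1; 0] then
    pairwise (fun u v => (u != 0) || (v == 0)) (behead w)
  else if tau == [:: 0; 1; 0; 0] then pairwise (fun u v => (u == 0) || (v != 0)) w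
  else if tau == [:: 0; 1; 1; 0] then pairwise (fun u v => (u == 0) || (u != v)) w
  else true.

Definition pos_ok (tau w : seq nat) (x : nat) : bool :=
  (tau == [:: 0; 1; 2; 3]) ==>
  pairwise (fun u v => [|| u == 0, v <= u | x <= v]) w.

Definition allowed (tau w : seq nat) (x : nat) : bool :=
  (x <= asc w + 1) &&
  (if x == 0 then zero_ok tau w else (mx w <= x) && pos_ok tau w x).

Definition good (tau w : seq nat) : bool :=
  [&& w != [::], ascent_seq w, avoids w [:: 0; 2; 1] & avoids w tau].

(** The initial 0, the maximum and a smaller positive [x] form 021. Conversely, a new occurrence
    ends in [x], which is then positive and below an earlier letter. *)
Lemma avoids021_rcons (v : seq nat) (x : nat) :
  avoids (rcons (0 :: v) x) [:: 0; 2; 1] =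
  avoids (0 :: v) [:: 0; 2; 1] && ((x == 0) || (mx (0 :: v) <= x)).
Proof.
rewrite /avoids; apply/idP/idP => [h | /andP[h hx]].
  apply/andP; split; first by apply: contra h => h; apply/contains_rconsP; left.
  apply: contraR h; rewrite negb_or -ltnNge => /andP[x0 xm].
  apply/contains_rconsP; right; exists [:: 0; mx (0 :: v)].
    have := mx_in (0 :: v) (leq_ltn_trans (leq0n _) xm).
    rewrite inE => /orP[/eqP m0 | mv]; first by rewrite m0 in xm.
    by rewrite /= sub1seq.
  by rewrite /same_order /=; lia.
apply/negP => /contains_rconsP[| [s sw]]; first exact/negP.
case: s sw => [|a [|c [|? ?]]] sw; rewrite /same_order //= => iso;
  last by move: iso; rewrite size_rcons.
have cw : c \in 0 :: v by apply: (mem_subseq sw); rewrite !inE eqxx orbT.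
by have := leq_mx _ _ cw; lia.
Qed.

Definition patterns : seq (seq nat) :=
  [:: [:: 0; 0; 1; 0]; [:: 0; 1; 0; 0]; [:: 0; 1; 1; 0]; [:: 0; 1; 2; 3]].

(** Without its first and last letters, an occurrence ending in [x] is a pair located after the
    initial 0 that violates the condition; conversely, the initial 0 and [x] complete any violating
    pair. The hypothesis on [x] forces [x = 0] for the three patterns ending in 0. *)
Lemma completes_pattern (tau v : seq nat) (x : nat) :
  tau \in patterns -> (x == 0) || (mx (0 :: v) <= x) ->
  (exists2 s, subseq s (0 :: v) & same_order (rcons s x) tau) <->
  ~~ (if x == 0 then zero_ok tau (0 :: v) else pos_ok tau (0 :: v) x).
Proof.
move=> htau hx; split.
  case=> s sw iso; apply/negP => ok.
  have {}ok : (x == 0 -> zero_ok tau (0 :: v)) /\ (x != 0 -> pos_ok tau (0 :: v) x).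
    by case: (x == 0) ok.
  have le_mx y : y \in s -> y <= mx (0 :: v).
    by move=> ys; apply/leq_mx/(mem_subseq sw).
  have sz_s : size s = 3.
    case/andP: iso; rewrite size_rcons.
    by move: htau; rewrite !inE => /or4P[] /eqP -> /= /eqP[].
  case: s sz_s sw iso le_mx => [|a [|c [|d [|? ?]]]] // _ sw iso le_mx.
  have la : a <= mx (0 :: v) by apply: le_mx; rewrite inE eqxx.
  have lc : c <= mx (0 :: v) by apply: le_mx; rewrite !inE eqxx orbT.
  have ld : d <= mx (0 :: v) by apply: le_mx; rewrite !inE eqxx !orbT.
  have cd : subseq [:: c; d] v.
    have : subseq [:: c; d] (behead (0 :: v)).
      move: sw; rewrite /=; case: eqP => // _ h.
      exact: subseq_trans (subseq_cons _ _) h.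
    by [].
  move: ok; rewrite /zero_ok /pos_ok.
  move: htau iso; rewrite !inE => /or4P[] /eqP ->;
    rewrite /same_order /= => iso [ok0 ok1].
  - have /ok0/pairwise_subseqP/(_ c d cd) : x == 0 by lia.
    by lia.
  - have /ok0/= /andP[_ /pairwise_subseqP/(_ c d cd)] : x == 0 by lia.
    by lia.
  - have /ok0/= /andP[_ /pairwise_subseqP/(_ c d cd)] : x == 0 by lia.
    by lia.
  - have /ok1/= /andP[_ /pairwise_subseqP/(_ c d cd)] : x != 0 by lia.
    by lia.
(* Pairs starting with the initial 0 satisfy the conditions trivially, so a violating pair lies in
   [v]. *)
have all_true (p : pred nat) : p =1 predT -> all p v by move=> h; apply/allP => y _; rewrite h.
rewrite /zero_ok /pos_ok; move: htau; rewrite !inE => /or4P[] /eqP -> /=;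
  case: (posnP x) => [x0 | x_gt0] //=; rewrite ?all_true //=.
- move=> /pairwise_subseqPn[u [z [uz hr]]]; exists [:: 0; u; z]; rewrite /= ?eqxx //.
  by rewrite /same_order /=; lia.
- move=> /pairwise_subseqPn[u [z [uz hr]]]; exists [:: 0; u; z]; rewrite /= ?eqxx //.
  by rewrite /same_order /=; lia.
- move=> /pairwise_subseqPn[u [z [uz hr]]]; exists [:: 0; u; z]; rewrite /= ?eqxx //.
  by rewrite /same_order /=; lia.
- move=> /pairwise_subseqPn[u [z [uz hr]]]; exists [:: 0; u; z]; rewrite /= ?eqxx //.
  have zw : z \in 0 :: v by apply/mem_behead/(mem_subseq uz); rewrite !inE eqxx orbT.
  by have := leq_mx _ _ zw; rewrite /same_order /=; lia.
Qed.

Lemma good_rcons (tau w : seq nat) (x : nat) :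
  tau \in patterns -> w != [::] ->
  good tau (rcons w x) = good tau w && allowed tau w x.
Proof.
move=> htau w0; rewrite /good w0 ascent_seq_rcons //.
have -> : rcons w x != [::] by case: (w).
case aw: (ascent_seq w) => //=; rewrite /allowed.
case: (leqP x (asc w + 1)) => //= _; last by rewrite andbF.
have [v ->] : exists v, w = 0 :: v.
  by case: w w0 aw => // y v _; rewrite /ascent_seq /= => /andP[/eqP -> _]; exists v.
rewrite avoids021_rcons; case: (avoids (0 :: v) [:: 0; 2; 1]) => //=.
have -> P Q : (if x == 0 then P else (mx (0 :: v) <= x) && Q) =
  ((x == 0) || (mx (0 :: v) <= x)) && (if x == 0 then P else Q) by case: (x == 0).
case hx: ((x == 0) || _) => /=; last by rewrite andbF.
have hc := completes_pattern _ _ _ htau hx; rewrite /avoids -rcons_cons.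
apply/idP/andP => [h | [h ok]].
  split; first by apply: contra h => h; apply/contains_rconsP; left.
  apply: contraR h => /hc h; apply/contains_rconsP; by right.
apply/negP => /contains_rconsP[| /hc]; first exact/negP.
by rewrite ok.
Qed.

(** * Counting extensions *)

(** The range [index_iota 0 (asc w + 2)] contains every letter up to [asc w + 1], the bound for an
    ascent sequence. *)
Fixpoint extensions (tau : seq nat) (k : nat) (w : seq nat) : seq (seq nat) :=
  if k is k'.+1 then
    [seq u | x <- [seq x <- index_iota 0 (asc w + 2) | allowed tau w x],
             u <- extensions tau k' (rcons w x)]
  else [:: w].

Lemma mem_extensions (tau : seq nat) (k : nat) (w u : seq nat) :
  tau \in patterns -> good tau w ->
  u \in extensions tau k w <->
  good tau u /\ exists2 v, u = w ++ v & size v = k.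
Proof.
move=> htau; elim: k w u => [|k IH] w u gw /=.
  rewrite inE; split=> [/eqP -> | [_ [v -> /eqP]]].
    by split=> //; exists [::]; rewrite ?cats0.
  by rewrite size_eq0 => /eqP ->; rewrite cats0.
have w0 : w != [::] by case/and4P: gw.
split=> [/allpairsPdep[x [u' [xw u'w def_u]]] | [gu [v def_u sz_v]]].
  move: xw; rewrite mem_filter => /andP[ax _].
  have gx : good tau (rcons w x) by rewrite good_rcons // gw.
  rewrite -def_u in u'w; have [gu [v def_v sz_v]] := (IH _ _ gx).1 u'w.
  by split; [ | exists (x :: v); rewrite -?cat_rcons //= sz_v].
case: v sz_v def_u => // x v [sz_v]; rewrite -cat_rcons => def_u.
have gx : good tau (rcons w x).
  (* Strip the letters of [v] from the end; by [good_rcons] the word stays good. *)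
  clear IH; elim/last_ind: v u gu def_u {sz_v} => [|v y IHv] u gu def_u; first by rewrite -[rcons w x]cats0 -def_u.
  apply: (IHv (rcons w x ++ v)) => //; move: gu; rewrite def_u -rcons_cat good_rcons //.
    by case/andP.
  by case: (w).
have := gx; rewrite good_rcons // gw => /= ax.
apply/allpairsPdep; exists x, u; split=> //; last by apply/IH => //; split=> //; exists v.
rewrite mem_filter ax mem_index_iota /=; case/andP: ax.
by lia.
Qed.

Lemma uniq_extensions (tau : seq nat) (k : nat) (w : seq nat) :
  tau \in patterns -> good tau w -> uniq (extensions tau k w).
Proof.
move=> htau; elim: k w => //= k IH w gw.
have w0 : w != [::] by case/and4P: gw.
have gx x : x \in [seq x <- index_iota 0 (asc w + 2) | allowed tau w x] ->
    good tau (rcons w x).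
  by rewrite mem_filter good_rcons // gw => /andP[].
apply: allpairs_uniq_dep; first by rewrite filter_uniq // iota_uniq.
  by move=> x /gx; apply: IH.
move=> p q /allpairsPdep[x [u [xw uw ->]]] /allpairsPdep[y [u' [yw u'w ->]]] /= eq_u.
(* Words grown from different letters differ at position [size w]. *)
suff eq_xy : x = y by move: uw u'w; rewrite eq_u eq_xy.
have [_ [v def_u _]] := (mem_extensions _ k _ _ htau (gx _ xw)).1 uw.
have [_ [v' def_u' _]] := (mem_extensions _ k _ _ htau (gx _ yw)).1 u'w.
have : nth 0 u (size w) = nth 0 u' (size w) by rewrite eq_u.
by rewrite def_u def_u' !cat_rcons !nth_cat ltnn subnn.
Qed.

Lemma avoids_short (w t : seq nat) : size w < size t -> avoids w t.
Proof.
move=> wt; apply/negP => /contains_subseqP[s sw /andP[/eqP sz_s _]].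
by have := size_subseq sw; rewrite sz_s leqNgt wt.
Qed.

Lemma size_patterns (tau : seq nat) : tau \in patterns -> size tau = 4.
Proof. by rewrite !inE => /or4P[] /eqP ->. Qed.

Lemma b0 (tau : seq nat) : tau \in patterns -> b 0 tau = 1.
Proof.
move=> htau; have [s [us ms] <-] := card_inB 0 tau.
rewrite (perm_size (uniq_perm us (isT : uniq [:: [::]]) _)) // => w.
rewrite ms !inE /inB size_eq0; case: eqP => //= ->.
rewrite !avoids_short ?(size_patterns _ htau) // !andbT /ascent_seq /=.
by apply/forallP => -[].
Qed.

(** Every non-empty ascent sequence starts with 0, so it extends [[:: 0]]. *)
Lemma bS (tau : seq nat) (k : nat) :
  tau \in patterns -> b k.+1 tau = size (extensions tau k [:: 0]).
Proof.
move=> htau; have g0 : good tau [:: 0].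
  rewrite /good !avoids_short ?(size_patterns _ htau) // !andbT /ascent_seq /=.
  by apply/forallP => -[[]].
have [s [us ms] <-] := card_inB k.+1 tau; apply: perm_size.
apply: uniq_perm => //; first exact: uniq_extensions.
move=> u; rewrite ms inE /inB; apply/and4P/idP => [[/eqP sz_u au a1 a2] | ].
  apply/mem_extensions => //; case: u sz_u au a1 a2 => // y v [sz_v] au a1 a2.
  have y0 : y = 0 by case/andP: au => /eqP.
  split; first by rewrite /good /= au a1.
  by exists v; rewrite ?y0.
move/mem_extensions => /(_ htau g0)[/and4P[_ au a1 a2] [v def_u sz_v]].
by rewrite au a1 a2 def_u /= sz_v eqxx.
Qed.

Lemma size_extensionsS (tau : seq nat) (k : nat) (w : seq nat) :
  size (extensions tau k.+1 w) =
  \sum_(0 <= x < asc w + 2 | allowed tau w x) size (extensions tau k (rcons w x)).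
Proof. by rewrite /= size_allpairs_dep sumnE big_map big_filter. Qed.

(* [m], [a], [l] are the maximum, the number of ascents and the last letter. *)
Definition state (w : seq nat) (m a l : nat) : Prop :=
  [/\ w != [::], mx w = m, asc w = a & last 0 w = l].

Lemma state_rcons (w : seq nat) (m a l x : nat) :
  state w m a l -> state (rcons w x) (maxn m x) (a + (l < x)) x.
Proof.
by case=> w0 <- <- <-; split; rewrite ?mx_rcons ?asc_rcons ?last_rcons //; case: (w).
Qed.

Lemma state_same (w : seq nat) (m a l : nat) :
  state w m a l -> state (rcons w m) m (a + (l < m)) m.
Proof. by move/(state_rcons _ _ _ _ m); rewrite maxnn. Qed.

Lemma state_up (w : seq nat) (m a l x : nat) :
  state w m a l -> m < x -> state (rcons w x) x (a + (l < x)) x.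
Proof. by move/(state_rcons _ _ _ _ x) => + h; rewrite (maxn_idPr (ltnW h)). Qed.

Lemma state_zero (w : seq nat) (m a l : nat) :
  state w m a l -> state (rcons w 0) m a 0.
Proof. by move/(state_rcons _ _ _ _ 0); rewrite maxn0 ltn0 addn0. Qed.

Lemma state_mem (w : seq nat) (m a l : nat) : state w m a l -> 0 < m -> m \in w.
Proof. by case=> _ <- _ _; apply: mx_in. Qed.

Lemma state_leq (w : seq nat) (m a l u : nat) : state w m a l -> u \in w -> u <= m.
Proof. by case=> _ <- _ _; apply: leq_mx. Qed.

Lemma zero_ok_rcons (tau w : seq nat) (x : nat) :
  zero_ok tau (rcons w x) -> zero_ok tau w.
Proof.
rewrite /zero_ok; case: w => [|y w]; first by rewrite /= !if_same.
case: ifP => _; first by rewrite /= pairwise_rcons => /andP[].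
by do 2![case: ifP => _; first by rewrite pairwise_rcons => /andP[]].
Qed.

Lemma zero_not_ok_rcons (tau w : seq nat) (x : nat) :
  zero_ok tau w = false -> zero_ok tau (rcons w x) = false.
Proof. by move=> zw; apply: contraFF zw; apply: zero_ok_rcons. Qed.

Lemma pos_ok_rcons (tau w : seq nat) (x y : nat) :
  pos_ok tau (rcons w y) x -> pos_ok tau w x.
Proof. by rewrite /pos_ok; case: eqP => //= _; rewrite pairwise_rcons => /andP[]. Qed.

(** The lower end [maxn 1 m] keeps the letter 0 out of the sum when [w] has maximum 0. *)
Lemma size_extensions_state (tau w : seq nat) (k m a l : nat) :
  state w m a l -> maxn 1 m <= a + 2 ->
  size (extensions tau k.+1 w) =
  (if zero_ok tau w then size (extensions tau k (rcons w 0)) else 0) +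
  \sum_(maxn 1 m <= x < a + 2 | pos_ok tau w x) size (extensions tau k (rcons w x)).
Proof.
case=> _ <- <- _ hm; rewrite size_extensionsS big_ltn_cond ?addn2 //.
have -> : allowed tau w 0 = zero_ok tau w by rewrite /allowed leq0n.
rewrite addn2 in hm.
have -> : \sum_(1 <= x < (asc w).+2 | allowed tau w x) size (extensions tau k (rcons w x))
  = \sum_(maxn 1 (mx w) <= x < (asc w).+2 | pos_ok tau w x) size (extensions tau k (rcons w x)).
  rewrite (big_cat_nat (leq_maxl 1 (mx w)) hm) /= big_nat_cond big_pred0 => [|x]; last first.
    by rewrite /allowed; case: eqP => //; lia.
  rewrite add0n big_nat_cond [RHS]big_nat_cond; apply: eq_bigl => x.
  case hx: (_ <= x < _) => //=; rewrite /allowed.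
  have -> : x <= asc w + 1 by lia.
  have -> : (x == 0) = false by lia.
  by have -> : mx w <= x by lia.
by case: (zero_ok tau w).
Qed.

(** * Recurrences common to 0010, 0100 and 0110 *)

Section WithoutIncreasing.

Variable tau : seq nat.
Hypothesis tau_neq : tau != [:: 0; 1; 2; 3].

Let pos_okT w x : pos_ok tau w x.
Proof. by rewrite /pos_ok (negPf tau_neq). Qed.

Lemma size_extensions_zeros (w : seq nat) (k : nat) :
  state w 0 0 0 ->
  size (extensions tau k.+1 w) =
  (if zero_ok tau w then size (extensions tau k (rcons w 0)) else 0) +
  size (extensions tau k (rcons w 1)).
Proof.
by move=> st; rewrite (size_extensions_state _ _ _ _ _ _ st) // big_ltn_cond // pos_okT big_geq // addn0.
Qed.

Lemma size_extensions_slack0 (w : seq nat) (k m l : nat) :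
  state w m m l -> 0 < m ->
  size (extensions tau k.+1 w) =
  (if zero_ok tau w then size (extensions tau k (rcons w 0)) else 0) +
  (size (extensions tau k (rcons w m)) + size (extensions tau k (rcons w m.+1))).
Proof.
move=> st m0; rewrite (size_extensions_state _ _ _ _ _ _ st) ?addn2; last by lia.
rewrite (maxn_idPr m0) big_ltn_cond; last by lia.
by rewrite big_ltn_cond // !pos_okT big_geq // addn0.
Qed.

Lemma size_extensions_slack1 (w : seq nat) (k m l : nat) :
  state w m m.+1 l -> 0 < m ->
  size (extensions tau k.+1 w) =
  (if zero_ok tau w then size (extensions tau k (rcons w 0)) else 0) +
  (size (extensions tau k (rcons w m)) + (size (extensions tau k (rcons w m.+1)) +
   size (extensions tau k (rcons w m.+2)))).
Proof.
move=> st m0; rewrite (size_extensions_state _ _ _ _ _ _ st) ?addn2; last by lia.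
rewrite (maxn_idPr m0) big_ltn_cond; last by lia.
rewrite big_ltn_cond; last by lia.
by rewrite big_ltn_cond // !pos_okT big_geq // addn0.
Qed.

(** Appending [m] or [m.+1] leads back to a state of the same shape, so the count doubles. *)
Lemma size_extensions_nozero0 (k : nat) (w : seq nat) (m : nat) :
  state w m m m -> 0 < m -> zero_ok tau w = false ->
  size (extensions tau k w) = 2 ^ k.
Proof.
elim: k w m => // k IH w m st m0 zw.
rewrite (size_extensions_slack0 _ _ _ _ st m0) zw add0n.
have st1 := state_same _ _ _ _ st; rewrite ltnn addn0 in st1.
have st2 := state_up _ _ _ _ m.+1 st (ltnSn m); rewrite ltnSn addn1 in st2.
by rewrite (IH _ _ st1) ?(IH _ _ st2) ?zero_not_ok_rcons // expnS; lia.
Qed.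

(** From slack 1, the letters [m] and [m.+1] keep the slack and [m.+2] reduces it to 0, so the count
    satisfies [S (k + 1) = 2 * S k + 2 ^ k]. *)
Lemma size_extensions_nozero1 (k : nat) (w : seq nat) (m : nat) :
  state w m m.+1 m -> 0 < m -> zero_ok tau w = false ->
  2 * size (extensions tau k w) = 2 ^ k * (k + 2).
Proof.
elim: k w m => // k IH w m st m0 zw.
rewrite (size_extensions_slack1 _ _ _ _ st m0) zw add0n.
have st1 := state_same _ _ _ _ st; rewrite ltnn addn0 in st1.
have st2 := state_up _ _ _ _ m.+1 st (ltnSn m); rewrite ltnSn addn1 in st2.
have st3 := state_up _ _ _ _ m.+2 st (leqnSn m.+1); rewrite leqnSn addn1 in st3.
have := IH _ _ st1 m0 (zero_not_ok_rcons _ _ _ zw).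
have := IH _ _ st2 isT (zero_not_ok_rcons _ _ _ zw).
have := size_extensions_nozero0 k _ _ st3 isT (zero_not_ok_rcons _ _ _ zw).
by rewrite expnS => -> ? ?; lia.
Qed.

(** After a final zero even the letter [m] makes an ascent and raises the slack to 1, while [m.+1]
    leaves it at 0. *)
Lemma size_extensions_lastzero_nozero (k : nat) (w : seq nat) (m : nat) :
  state w m m 0 -> 0 < m ->
  zero_ok tau (rcons w m) = false -> zero_ok tau (rcons w m.+1) = false ->
  2 * (size (extensions tau k (rcons w m)) + size (extensions tau k (rcons w m.+1))) =
  2 ^ k * (k + 4).
Proof.
move=> st m0 z1 z2.
have st1 := state_same _ _ _ _ st; rewrite m0 addn1 in st1.
have st2 := state_up _ _ _ _ m.+1 st (ltnSn m); rewrite ltn0Sn addn1 in st2.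
rewrite mulnDr (size_extensions_nozero1 _ _ _ st1) //.
by rewrite (size_extensions_nozero0 _ _ _ st2) //; lia.
Qed.

End WithoutIncreasing.

Lemma behead_rcons (T : eqType) (s : seq T) (x : T) :
  s != [::] -> behead (rcons s x) = rcons (behead s) x.
Proof. by case: s. Qed.

(** * The pattern 0110 *)

Lemma zero_ok_0110_rcons (w : seq nat) (x : nat) :
  zero_ok [:: 0; 1; 1; 0] (rcons w x) =
  ((x == 0) || (x \notin w)) && zero_ok [:: 0; 1; 1; 0] w.
Proof.
rewrite /zero_ok /= pairwise_rcons; congr (_ && _).
have [-> | x0] /= := eqVneq x 0; first by apply/allP => u _; case: eqP.
apply/allP/idP => [h | xw u uw].
  by apply/negP => /h; rewrite eqxx (negPf x0).
by apply/orP; right; apply: contraNneq xw => <-.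
Qed.

(** Let [P k] and [Z k] be the counts when [w] ends with its maximum and with 0. A second [m]
    forbids zeros and [m.+1] does not, so [P (k + 1) = Z k + 2 ^ k + P k] and [2 * Z (k + 1) = 2 * Z
    k + 2 ^ k * (k + 2) + 2 * P k]. The matrix of this system has eigenvalues 2 and 0; the latter
    explains the terms in [k == 0], which cancel in [P k + Z k]. *)
Lemma size_extensions_0110 (k : nat) (w : seq nat) (m : nat) :
  0 < m -> zero_ok [:: 0; 1; 1; 0] w ->
  (state w m m m -> 16 * size (extensions [:: 0; 1; 1; 0] k w) + 2 * (k == 0) =
     2 ^ k * (k ^ 2 + 5 * k + 18)) /\
  (state w m m 0 -> 16 * size (extensions [:: 0; 1; 1; 0] k w) =
     2 ^ k * (k ^ 2 + 9 * k + 14) + 2 * (k == 0)).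
Proof.
elim: k w m => [|k IH] w m m0 zw; first by split=> _; rewrite /=.
have zm l a : state w m a l -> zero_ok [:: 0; 1; 1; 0] (rcons w m) = false.
  by move/state_mem => mw; rewrite zero_ok_0110_rcons (mw m0) eqn0Ngt m0.
have zm1 l a : state w m a l -> zero_ok [:: 0; 1; 1; 0] (rcons w m.+1).
  move=> st; rewrite zero_ok_0110_rcons zw andbT /=.
  by apply/negP => /(state_leq _ _ _ _ _ st); rewrite ltnn.
have z0 : zero_ok [:: 0; 1; 1; 0] (rcons w 0) by rewrite zero_ok_0110_rcons.
split=> st; rewrite (size_extensions_slack0 _ _ _ _ _ _ st) // zw.
  have st0 := state_zero _ _ _ _ st.
  have st1 := state_same _ _ _ _ st; rewrite ltnn addn0 in st1.
  have st2 := state_up _ _ _ _ m.+1 st (ltnSn m); rewrite ltnSn addn1 in st2.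
  have := (IH _ _ m0 z0).2 st0; have := (IH _ _ (ltn0Sn m) (zm1 _ _ st)).1 st2.
  have := size_extensions_nozero0 [:: 0; 1; 1; 0] isT k _ _ st1 m0 (zm _ _ st).
  by rewrite expnS !expnS; nia.
have st0 := state_zero _ _ _ _ st.
have st1 := state_same _ _ _ _ st; rewrite m0 addn1 in st1.
have st2 := state_up _ _ _ _ m.+1 st (ltnSn m); rewrite ltn0Sn addn1 in st2.
have := (IH _ _ m0 z0).2 st0; have := (IH _ _ (ltn0Sn m) (zm1 _ _ st)).1 st2.
have := size_extensions_nozero1 [:: 0; 1; 1; 0] isT k _ _ st1 m0 (zm _ _ st).
by rewrite expnS !expnS; nia.
Qed.

(** Only zeros so far: another zero keeps the state, and the first 1 leads to [size_extensions_0110]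
    with maximum 1. *)
Lemma size_extensions_zeros_0110 (k : nat) (w : seq nat) :
  state w 0 0 0 -> zero_ok [:: 0; 1; 1; 0] w ->
  16 * size (extensions [:: 0; 1; 1; 0] k w) = 2 ^ k * (k ^ 2 + k + 14) + 2 * (k == 0).
Proof.
elim: k w => [|k IH] w st zw //.
rewrite (size_extensions_zeros _ _ _ _ st) // zw.
have := IH _ (state_zero _ _ _ _ st); rewrite zero_ok_0110_rcons => /(_ zw).
have st1 := state_up _ _ _ _ 1 st isT.
have z1 : zero_ok [:: 0; 1; 1; 0] (rcons w 1).
  rewrite zero_ok_0110_rcons zw andbT /=.
  by apply/negP => /(state_leq _ _ _ _ _ st).
have := (size_extensions_0110 k _ 1 isT z1).1 st1.
by rewrite expnS !expnS; nia.
Qed.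

(** * The pattern 0100 *)

Lemma zero_ok_0100_rcons (w : seq nat) (x : nat) :
  zero_ok [:: 0; 1; 0; 0] (rcons w x) =
  ((x != 0) || all (pred1 0) w) && zero_ok [:: 0; 1; 0; 0] w.
Proof.
rewrite /zero_ok /= pairwise_rcons; congr (_ && _).
case: (x =P 0) => _ /=; first by apply: eq_all => u; rewrite /= orbF.
by apply/allP => u _; rewrite orbT.
Qed.

(** No zero has yet followed a positive letter. Either positive letter returns to such a state, and
    a zero forbids further zeros, with the count [hz]. *)
Lemma size_extensions_0100 (k : nat) (w : seq nat) (m : nat) :
  0 < m -> state w m m m -> zero_ok [:: 0; 1; 0; 0] w ->
  16 * size (extensions [:: 0; 1; 0; 0] k w) + 2 * (k == 0) = 2 ^ k * (k ^ 2 + 5 * k + 18).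
Proof.
elim: k w m => [|k IH] w m m0 st zw //.
rewrite (size_extensions_slack0 _ _ _ _ _ _ st) // zw.
have st0 := state_zero _ _ _ _ st.
have st1 := state_same _ _ _ _ st; rewrite ltnn addn0 in st1.
have st2 := state_up _ _ _ _ m.+1 st (ltnSn m); rewrite ltnSn addn1 in st2.
have := IH _ _ m0 st1; rewrite zero_ok_0100_rcons -lt0n m0 => /(_ zw).
have := IH _ m.+1 isT st2; rewrite zero_ok_0100_rcons => /(_ zw).
have z0 : zero_ok [:: 0; 1; 0; 0] (rcons w 0) = false.
  rewrite zero_ok_0100_rcons /=; apply/negP => /andP[/allP h _].
  by move: (m0); rewrite (eqP (h _ (state_mem _ _ _ _ st m0))).
(* The next letter can only be [m] or [m.+1]; the term [k == 0] accounts for the extension of length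
   0. *)
have hz : 4 * size (extensions [:: 0; 1; 0; 0] k (rcons w 0)) =
    2 ^ k * (k + 3) + (k == 0).
  case: k {IH} => // k; rewrite (size_extensions_slack0 _ _ _ _ _ _ st0) // z0.
  have := size_extensions_lastzero_nozero [:: 0; 1; 0; 0] isT k _ _ st0 m0
    (zero_not_ok_rcons _ _ _ z0) (zero_not_ok_rcons _ _ _ z0).
  by rewrite expnS; nia.
by rewrite expnS !expnS; nia.
Qed.

Lemma size_extensions_zeros_0100 (k : nat) (w : seq nat) :
  state w 0 0 0 -> zero_ok [:: 0; 1; 0; 0] w ->
  16 * size (extensions [:: 0; 1; 0; 0] k w) = 2 ^ k * (k ^ 2 + k + 14) + 2 * (k == 0).
Proof.
elim: k w => [|k IH] w st zw //.
rewrite (size_extensions_zeros _ _ _ _ st) // zw.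
have w0 : all (pred1 0) w.
  by apply/allP => u /(state_leq _ _ _ _ _ st); rewrite leqn0.
have := IH _ (state_zero _ _ _ _ st); rewrite zero_ok_0100_rcons w0 => /(_ zw).
have st1 := state_up _ _ _ _ 1 st isT.
have := size_extensions_0100 k _ 1 isT st1; rewrite zero_ok_0100_rcons => /(_ zw).
by rewrite expnS !expnS; nia.
Qed.

(** * The pattern 0010 *)

Lemma zero_ok_0010_rcons (w : seq nat) (x : nat) :
  w != [::] ->
  zero_ok [:: 0; 0; 1; 0] (rcons w x) =
  ((x == 0) || (0 \notin behead w)) && zero_ok [:: 0; 0; 1; 0] w.
Proof.
case: w => // y w _; rewrite /zero_ok /= pairwise_rcons; congr (_ && _).
case: (x =P 0) => _ /=; first by apply/allP => u _; rewrite orbT.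
apply/allP/idP => [h | hw u uw]; first by apply/negP => /h.
by rewrite orbF; apply: contraNneq hw => <-.
Qed.

(** As a zero already lies past the first position, the next positive letter forbids zeros; a
    further zero keeps the state. *)
Lemma size_extensions_0010_lastzero (k : nat) (w : seq nat) (m : nat) :
  0 < m -> state w m m 0 -> zero_ok [:: 0; 0; 1; 0] w -> 0 \in behead w ->
  2 * size (extensions [:: 0; 0; 1; 0] k w) = 2 ^ k * (k + 2).
Proof.
elim: k w m => [|k IH] w m m0 st zw w0 //.
have wN : w != [::] by case: st.
rewrite (size_extensions_slack0 _ _ _ _ _ _ st) // zw.
have := IH _ _ m0 (state_zero _ _ _ _ st); rewrite zero_ok_0010_rcons // => /(_ zw).
rewrite behead_rcons ?mem_rcons ?inE // => /(_ isT).
have := size_extensions_lastzero_nozero [:: 0; 0; 1; 0] isT k _ _ st m0.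
rewrite !zero_ok_0010_rcons // w0 eqn0Ngt m0 /= => /(_ erefl erefl).
by rewrite expnS; nia.
Qed.

(** With no zero past the first position, positive letters keep zeros permitted; the first new zero
    leads to [size_extensions_0010_lastzero]. *)
Lemma size_extensions_0010 (k : nat) (w : seq nat) (m : nat) :
  0 < m -> state w m m m -> zero_ok [:: 0; 0; 1; 0] w -> 0 \notin behead w ->
  8 * size (extensions [:: 0; 0; 1; 0] k w) = 2 ^ k * (k ^ 2 + 3 * k + 8).
Proof.
elim: k w m => [|k IH] w m m0 st zw w0 //.
have wN : w != [::] by case: st.
rewrite (size_extensions_slack0 _ _ _ _ _ _ st) // zw.
have st1 := state_same _ _ _ _ st; rewrite ltnn addn0 in st1.
have st2 := state_up _ _ _ _ m.+1 st (ltnSn m); rewrite ltnSn addn1 in st2.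
have := size_extensions_0010_lastzero k _ _ m0 (state_zero _ _ _ _ st).
rewrite zero_ok_0010_rcons // => /(_ zw).
rewrite behead_rcons ?mem_rcons ?inE // => /(_ isT).
have := IH _ _ m0 st1; rewrite zero_ok_0010_rcons // w0 orbT => /(_ zw).
rewrite behead_rcons ?mem_rcons ?inE // negb_or w0 eq_sym -lt0n m0 => /(_ isT).
have := IH _ m.+1 isT st2; rewrite zero_ok_0010_rcons // w0 orbT => /(_ zw).
rewrite behead_rcons ?mem_rcons ?inE // => /(_ w0).
by rewrite expnS !expnS; nia.
Qed.

(** The word consists of at least two zeros, so the first 1 forbids zeros and leaves [2 ^ k]
    extensions. *)
Lemma size_extensions_zeros_0010 (k : nat) (w : seq nat) :
  state w 0 0 0 -> zero_ok [:: 0; 0; 1; 0] w -> 0 \in behead w ->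
  size (extensions [:: 0; 0; 1; 0] k w) = 2 ^ k.
Proof.
elim: k w => [|k IH] w st zw w0 //.
have wN : w != [::] by case: st.
rewrite (size_extensions_zeros _ _ _ _ st) // zw.
have := IH _ (state_zero _ _ _ _ st); rewrite zero_ok_0010_rcons // => /(_ zw).
rewrite behead_rcons ?mem_rcons ?inE // => /(_ isT) ->.
have st1 := state_up _ _ _ _ 1 st isT.
have := size_extensions_nozero0 [:: 0; 0; 1; 0] isT k _ _ st1 isT.
rewrite zero_ok_0010_rcons // w0 /= => /(_ erefl) ->.
by rewrite expnS; lia.
Qed.

(** * The pattern 0123 *)

Lemma zero_ok_0123 (w : seq nat) : zero_ok [:: 0; 1; 2; 3] w.
Proof. by []. Qed.

Lemma pos_ok_0123_rcons (w : seq nat) (x y : nat) :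
  pos_ok [:: 0; 1; 2; 3] (rcons w y) x =
  all (fun u => [|| u == 0, y <= u | x <= y]) w && pos_ok [:: 0; 1; 2; 3] w x.
Proof. by rewrite /pos_ok /= pairwise_rcons. Qed.

(* The two positive values have both been used: only zeros and copies of the
   larger one, [m], can follow. *)
Lemma size_extensions_0123_two (k : nat) (w : seq nat) (m a l : nat) :
  state w m a l -> 0 < m <= a.+1 ->
  pos_ok [:: 0; 1; 2; 3] w m -> (forall x, m < x -> pos_ok [:: 0; 1; 2; 3] w x = false) ->
  size (extensions [:: 0; 1; 2; 3] k w) = 2 ^ k.
Proof.
elim: k w a l => // k IH w a l st hm okm no.
rewrite (size_extensions_state _ _ _ _ _ _ st) ?zero_ok_0123; last by lia.
have -> : maxn 1 m = m by lia.
have no' y x : m < x -> pos_ok [:: 0; 1; 2; 3] (rcons w y) x = false.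
  by move/no; apply: contraFF; apply: pos_ok_rcons.
have ok0 : pos_ok [:: 0; 1; 2; 3] (rcons w 0) m.
  by rewrite pos_ok_0123_rcons okm andbT; apply/allP => u _; case: (u =P 0).
have ok1 : pos_ok [:: 0; 1; 2; 3] (rcons w m) m.
  by rewrite pos_ok_0123_rcons okm leqnn andbT; apply/allP => u _; rewrite !orbT.
have hm' : 0 < m <= (a + (l < m)).+1 by lia.
rewrite (IH _ _ _ (state_zero _ _ _ _ st) hm ok0 (no' 0)) big_ltn_cond; last by lia.
rewrite okm (IH _ _ _ (state_same _ _ _ _ st) hm' ok1 (no' m)).
rewrite big_nat_cond big_pred0 => [|x]; first by rewrite expnS; lia.
by case hx: (m < x) => //=; rewrite no ?andbF.
Qed.

(** The pairwise hypothesis excludes two increasing positive letters, so every letter from 2 to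
    [a + 1] can follow. A 1 after a zero raises [a], which the induction therefore leaves free. The
    term [3 * k] stands on the left to avoid truncated subtraction. *)
Lemma size_extensions_0123 (k : nat) (w : seq nat) (a : nat) :
  pairwise (fun u v => (u == 0) || (v <= u)) w ->
  (state w 1 a 1 -> 16 * size (extensions [:: 0; 1; 2; 3] k w) + 2 * (k == 0) + 2 ^ k * (3 * k) =
     2 ^ k * (18 + 8 * a * k + k ^ 2)) /\
  (state w 1 a 0 -> 16 * size (extensions [:: 0; 1; 2; 3] k w) =
     2 ^ k * (14 + 8 * a * k + k ^ 2 + k) + 2 * (k == 0)).
Proof.
elim: k w a => [|k IH] w a pw; first by split=> _; rewrite /=; lia.
have ok x : pos_ok [:: 0; 1; 2; 3] w x.
  rewrite /pos_ok /=; apply: sub_pairwise pw => u v /= /orP[-> // | ->].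
  by rewrite orbT.
have all_same y : y <= 1 -> pairwise (fun u v => (u == 0) || (v <= u)) (rcons w y).
  by move=> y1; rewrite pairwise_rcons pw andbT; apply/allP => u _; lia.
(* Each of these [a] letters becomes the second positive value, after which [2 ^ k] extensions
   remain. *)
have two l : state w 1 a l ->
  \sum_(2 <= x < a + 2 | pos_ok [:: 0; 1; 2; 3] w x)
     size (extensions [:: 0; 1; 2; 3] k (rcons w x)) = a * 2 ^ k.
  move=> st; rewrite big_mkcond /= (@eq_big_nat _ _ _ _ _ _ (fun=> 2 ^ k)) => [|x /andP[x2 xa]].
    by rewrite sum_nat_const_nat; lia.
  rewrite ok; apply: (size_extensions_0123_two _ _ _ _ _ (state_up _ _ _ _ x st x2)).
  - by lia.
  - by rewrite pos_ok_0123_rcons ok leqnn andbT; apply/allP => u _; rewrite !orbT.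
  move=> y xy; rewrite pos_ok_0123_rcons; apply/negP => /andP[/allP h _].
  by have := h _ (state_mem _ _ _ _ st isT); lia.
have step l : state w 1 a l -> size (extensions [:: 0; 1; 2; 3] k.+1 w) =
    size (extensions [:: 0; 1; 2; 3] k (rcons w 0)) +
    (size (extensions [:: 0; 1; 2; 3] k (rcons w 1)) + a * 2 ^ k).
  move=> st; rewrite (size_extensions_state _ _ _ _ _ _ st) ?zero_ok_0123; last by lia.
  by rewrite big_ltn_cond ?ok ?(two _ st) //; lia.
split=> st; rewrite (step _ st).
  have st1 := state_same _ _ _ _ st; rewrite ltnn addn0 in st1.
  have := (IH _ _ (all_same 0 isT)).2 (state_zero _ _ _ _ st).
  have := (IH _ _ (all_same 1 isT)).1 st1.
  by rewrite expnS !expnS; nia.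
have st1 := state_same _ _ _ _ st; rewrite addn1 in st1.
have := (IH _ _ (all_same 0 isT)).2 (state_zero _ _ _ _ st).
have := (IH _ _ (all_same 1 isT)).1 st1.
by rewrite expnS !expnS; nia.
Qed.

Lemma size_extensions_zeros_0123 (k : nat) (w : seq nat) :
  state w 0 0 0 -> pairwise (fun u v => (u == 0) || (v <= u)) w ->
  16 * size (extensions [:: 0; 1; 2; 3] k w) = 2 ^ k * (k ^ 2 + k + 14) + 2 * (k == 0).
Proof.
elim: k w => [|k IH] w st pw //.
have all0 : all (fun u => u == 0) w.
  by apply/allP => u /(state_leq _ _ _ _ _ st); rewrite leqn0.
have pw' y : pairwise (fun u v => (u == 0) || (v <= u)) (rcons w y).
  by rewrite pairwise_rcons pw andbT; apply: sub_all all0 => u ->.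
rewrite (size_extensions_state _ _ _ _ _ _ st) ?zero_ok_0123 //.
have ok : pos_ok [:: 0; 1; 2; 3] w 1.
  rewrite /pos_ok /=; apply: sub_pairwise pw => u v /= /orP[-> // | ->].
  by rewrite orbT.
rewrite maxn0 big_ltn_cond // ok big_geq // addn0.
have := IH _ (state_zero _ _ _ _ st) (pw' 0).
have := (size_extensions_0123 k _ 1 (pw' 1)).1 (state_up _ _ _ _ 1 st isT).
by rewrite expnS !expnS; nia.
Qed.

(** * Closed form common to the four patterns *)

(** For [n = k.+1] the polynomial is [n ^ 2 - n + 14]; the last term corrects the count at length
    1. *)
Lemma b_patterns (tau : seq nat) (k : nat) :
  tau \in patterns -> 16 * b k.+1 tau = 2 ^ k * (k ^ 2 + k + 14) + 2 * (k == 0).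
Proof.
move=> htau; rewrite bS //.
have st : state [:: 0] 0 0 0.
  by split; rewrite // /mx /asc ?big_seq1 // big_nil.
move: htau; rewrite !inE => /or4P[] /eqP ->.
(* For 0010 a second zero and a 1 lead to different counts, so the second letter is split off. *)
- case: k => // k; rewrite (size_extensions_zeros _ _ _ _ st) //=.
  have := size_extensions_zeros_0010 k [:: 0; 0] (state_zero _ _ _ _ st) isT isT.
  have := size_extensions_0010 k [:: 0; 1] 1 isT (state_up _ _ _ _ 1 st isT) isT isT.
  by rewrite expnS !expnS; nia.
- exact: size_extensions_zeros_0100.
- exact: size_extensions_zeros_0110.
- exact: size_extensions_zeros_0123.
Qed.

(** * The generating function *)

Local Open Scope ring_scope.

(** The default value 0 of the list covers all degrees above 3. *)
Lemma coef_denominator (i : nat) :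
  ((1 - 2%:R *: 'X) ^+ 3 : {poly rat})`_i = [:: 1; - 6%:R; 12%:R; - 8%:R]`_i.
Proof.
have -> : (1 - 2%:R *: 'X) ^+ 3 =
    1 - 6%:R *: 'X + 12%:R *: 'X^2 - 8%:R *: 'X^3 :> {poly rat}.
  by rewrite -!mul_polyC; ring.
by rewrite !coefE; case: i => [|[|[|[|i]]]]; rewrite /= ?nth_nil //; ring.
Qed.

Lemma coef_numerator (i : nat) :
  ((1 - 'X) * (1 - 4%:R *: 'X + 4%:R *: 'X^2 + 'X^3) : {poly rat})`_i =
  [:: 1; - 5%:R; 8%:R; - 3%:R; - 1]`_i.
Proof.
have -> : (1 - 'X) * (1 - 4%:R *: 'X + 4%:R *: 'X^2 + 'X^3) =
    1 - 5%:R *: 'X + 8%:R *: 'X^2 - 3%:R *: 'X^3 - 'X^4 :> {poly rat}.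
  by rewrite -!mul_polyC; ring.
by rewrite !coefE; case: i => [|[|[|[|[|i]]]]]; rewrite /= ?nth_nil //; ring.
Qed.

(** Strong induction on the recurrence [rec], which expresses that the denominator times its inverse
    is 1. *)
Lemma fps_inv_denominator (n : nat) :
  fps_inv (fps_of_poly ((1 - 2%:R *: 'X) ^+ 3 : {poly rat})) n =
  2%:R ^+ n * ((n.+1)%:R * (n.+2)%:R / 2%:R).
Proof.
set g := fps_inv _.
have rec m : \sum_(i < m.+1) [:: 1; - 6%:R; 12%:R; - 8%:R]`_i * g (m - i)%N = (m == 0)%:R.
  have := @fps_mulV rat (fps_of_poly ((1 - 2%:R *: 'X) ^+ 3)) _ m.
  rewrite /fps_of_poly coef_denominator coef1 => /(_ isT) <-.
  by apply: eq_bigr => i _; rewrite coef_denominator.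
elim/ltn_ind: n => n IH; have := rec n.
(* The denominator has degree 3, so the recurrence has all its terms only from index 3 on. *)
case: n IH => [|[|[|n]]] IH; rewrite !big_ord_recl ?big_ord0 /= ?subSS ?subn0.
- by move=> h; lra.
- by rewrite (IH 0%N) //; lra.
- by rewrite (IH 0%N) // (IH 1%N) //; lra.
rewrite /bump /= big1 => [|i _]; last by rewrite nth_nil mul0r.
rewrite addr0 (IH n.+2) // (IH n.+1) ?(IH n) ?ltnS ?leqW //.
rewrite !exprS -!natr1 => h.
by lra.
Qed.

Theorem theorem2p1 (tau : seq nat)
  (htau : tau \in [:: [:: 0; 0; 1; 0]; [:: 0; 1; 0; 0];
                      [:: 0; 1; 1; 0]; [:: 0; 1; 2; 3]]%N) :
  gen_fun tau =1
  fps_div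
    (fps_of_poly ((1 - 'X) * (1 - 4%:R *: 'X + 4%:R *: 'X^2 + 'X^3)))
    (fps_of_poly ((1 - 2%:R *: 'X) ^+ 3)).
Proof.
move=> n; rewrite /fps_div /fps_mul /gen_fun.
under eq_bigr => i _ do rewrite /fps_of_poly coef_numerator fps_inv_denominator.
case: n => [|n]; first by rewrite big_ord_recl big_ord0 b0 //= /fps_of_poly; lra.
have := congr1 (fun m : nat => m%:R : rat) (b_patterns tau n htau).
rewrite !natrD !natrM !natrD !natrX.
(* The numerator has degree 4, so coefficients 1 to 3 are shorter sums, checked separately. *)
case: n => [|[|[|n]]]; rewrite !big_ord_recl ?big_ord0 /= ?subSS ?subn0.
- by lra.
- by lra.
- by lra.
rewrite /bump /= big1 => [|i _]; last by rewrite nth_nil mul0r.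
by rewrite addr0 !exprS expr0; lra.
Qed.
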